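(* Let $A \in \mathbb{R}^{M\times N}$ be any real matrix and let $K$ be a positive integer. If there exists a function $f:\mathbb{R}\to\mathbb{R}$ such that $f(A)$ has rank at least $K$, then there also exists a bijective, continuous, piecewise differentiable and strictly increasing function $g:\mathbb{R}\to\mathbb{R}$ such that $g(A)$ has rank at least $K$.
   Context: For a matrix $A\in\mathbb{R}^{M\times N}$ and a function $f:\mathbb{R}\to\mathbb{R}$, $f(A)$ denotes the $M\times N$ matrix obtained by applying $f$ to each entry: $f(A)_{ij} = f(A_{ij})$. *)

(* Defs.v *)
From HB Require Import structures.
From mathcomp Require Import all_boot all_order all_algebra.
From mathcomp Require Import all_classical all_reals all_analysis.
Import Order.TTheory GRing.Theory Num.Theory.
Import numFieldNormedType.Exports.

Set Implicit Arguments.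
Unset Strict Implicit.
Unset Printing Implicit Defensive.

Local Open Scope classical_set_scope.
Local Open Scope ring_scope.

(* The points of [s] cut the real line into finitely many closed intervals, on
   each of which the restriction of a continuous [g] is differentiable:
   two-sidedly in the interior, and one-sidedly (with a finite derivative) at
   each endpoint.  [s] need not be sorted and may be empty. *)
Definition piecewise_differentiable (R : realType) (g : R -> R) : Prop :=
  exists s : seq R,
    (forall x : R, x \notin s -> derivable g x 1) /\
    (forall x : R, x \in s ->
       cvg ((fun h : R => h^-1 * (g (x + h) - g x)) @ 0^'-) /\
       cvg ((fun h : R => h^-1 * (g (x + h) - g x)) @ 0^'+)).

(* Main.v *)
Require Import Defs.
From HB Require Import structures.
From mathcomp Require Import all_boot all_order all_algebra.
From mathcomp Require Import all_classical all_reals all_analysis.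
From mathcomp Require Import zify lra.
Import Order.TTheory GRing.Theory Num.Theory.
Import numFieldNormedType.Exports.

Set Implicit Arguments.
Unset Strict Implicit.
Unset Printing Implicit Defensive.

Local Open Scope classical_set_scope.
Local Open Scope ring_scope.

(** Choose a polynomial [P] such that [h := P \o atan] agrees with [f] on the
    entries of [A]; since [atan] takes values in a bounded interval, [h] and its
    derivative are bounded.  For [t > 0] small, [g x := x + t * h x] then
    has a positive derivative and stays at distance less than [1] from the
    identity, so it is an increasing differentiable bijection.
    As [f(A)] has rank at least [K], there are [U] and [V] with
    [U f(A) V = 1], whence [U g(A) V = U A V + t 1]: this [K x K] matrix is
    invertible unless [- t] is an eigenvalue of [U A V], which excludes only
    finitely many [t]. *)

(** In [B = col_ebase B *m pid_mx (\rank B) *m row_ebase B] the outer factors are invertible;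
    cancelling them and cutting the middle one down to its leading [k] by [k] block leaves the
    identity. *)
Lemma rank_ge_mulmx1 (F : fieldType) (m n k : nat) (B : 'M[F]_(m, n)) :
  (k <= \rank B)%N ->
  exists (U : 'M[F]_(k, m)) (V : 'M[F]_(n, k)), U *m B *m V = 1%:M.
Proof.
move=> le_k_rB.
exists (pid_mx k *m invmx (col_ebase B)), (invmx (row_ebase B) *m pid_mx k).
rewrite -{2}(mulmx_ebase B) !mulmxA mulmxKV ?col_ebase_unit //.
rewrite mulmxK ?row_ebase_unit // !mul_pid_mx -[RHS]pid_mx_1; congr pid_mx.
have := rank_leq_row B; have := rank_leq_col B; lia.
Qed.

Lemma rank_addZ_ge (F : fieldType) (m n k : nat) (B C : 'M[F]_(m, n))
    (U : 'M[F]_(k, m)) (V : 'M[F]_(n, k)) (t : F) :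
  U *m C *m V = 1%:M -> ~~ root (char_poly (U *m B *m V)) (- t) ->
  (k <= \rank (B + t *: C)%R)%N.
Proof.
move=> UCV1; rewrite -eigenvalue_root_char negbK => /eqP ker0.
suff <- : \rank (U *m (B + t *: C) *m V) = k.
  by apply: leq_trans (mxrankM_maxl _ _) (mxrankM_maxr _ _).
apply/eqP; rewrite -[_ == k]/(row_free _) -kermx_eq0.
rewrite mulmxDr mulmxDl -scalemxAr -scalemxAl UCV1 scalemx1.
by move: ker0; rewrite /eigenspace raddfN opprK => ->.
Qed.

(** Among the [size p] distinct candidates [e / 2], [e / 3], ... one is not a root, since a nonzero
    [p] has fewer than [size p] roots. *)
Lemma poly_nonroot_small (R : realType) (p : {poly R}) (e : R) :
  p != 0 -> 0 < e -> exists2 t : R, 0 < t < e & ~~ root p t.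
Proof.
move=> p_neq0 e_gt0; pose s := [seq e / i.+2%:R | i <- iota 0 (size p)].
have [/allP s_roots|/allPn[x /mapP[i _ ->] xNroot]] := boolP (all (root p) s).
  have s_uniq : uniq s.
    rewrite map_inj_uniq ?iota_uniq // => i j.
    move=> /(mulfI (lt0r_neq0 e_gt0)) /invr_inj /eqP.
    by rewrite eqr_nat => /eqP[].
  have := max_poly_roots p_neq0 (introT allP s_roots) s_uniq.
  by rewrite size_map size_iota ltnn.
exists (e / i.+2%:R) => //; rewrite divr_gt0 ?ltr0n //=.
by rewrite ltr_pdivrMr ?ltr0n // ltr_pMr // ltr1n.
Qed.

(** Newton interpolation: a new node [a] is handled by adding a multiple of [q], which vanishes at
    the earlier nodes and, [phi] being injective, not at [phi a]. *)
Lemma poly_interpolation (F : fieldType) (phi f : F -> F) (s : seq F) :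
  injective phi -> exists p : {poly F}, forall x, x \in s -> p.[phi x] = f x.
Proof.
move=> phi_inj; elim: s => [|a s [p p_s]]; first by exists 0.
have [a_s|aNs] := boolP (a \in s).
  by exists p => x; rewrite inE => /predU1P[->|]; apply: p_s.
pose q := \prod_(y <- s) ('X - (phi y)%:P).
have q_a : q.[phi a] != 0.
  rewrite horner_prod prodf_seq_neq0; apply/allP => y y_s /=.
  rewrite hornerXsubC subr_eq0 (inj_eq phi_inj).
  by apply: contraNneq aNs => ->.
exists (p + ((f a - p.[phi a]) / q.[phi a]) *: q) => x.
rewrite inE hornerD hornerZ => /predU1P[->|x_s].
  by rewrite divfK // addrC subrK.
rewrite p_s // [q.[phi x]]horner_prod (big_rem x) //= hornerXsubC subrr.
by rewrite mul0r mulr0 addr0.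
Qed.

Lemma poly_comp_bounded_derive (R : realType) (phi phi' : R -> R) (B : R)
    (p : {poly R}) :
  (forall x : R, is_derive x 1 phi (phi' x)) ->
  (forall x, `|phi x| <= B) -> (forall x, `|phi' x| <= B) ->
  exists (h' : R -> R) (C : R), forall x : R,
    [/\ is_derive x 1 (fun y => p.[phi y]) (h' x), `|p.[phi x]| <= C
      & `|h' x| <= C].
Proof.
move=> dphi phiB phi'B.
have B_ge0 : 0 <= B by apply: le_trans (phiB 0).
elim/poly_ind: p => [|p c [h' [C hC]]].
  exists (fun=> 0), 0 => x; rewrite horner0 normr0; split=> //.
  rewrite (_ : (fun _ => _) = cst 0); first exact: is_derive_cst.
  by apply/funext => y; rewrite horner0.
have C_ge0 : 0 <= C by have [_ + _] := hC 0; apply: le_trans.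
(* Each of the two Leibniz terms is at most [C * B]; the value needs only one [C * B] plus the
   constant coefficient [c]. *)
exists (fun x => p.[phi x] * phi' x + phi x * h' x), (2 * (C * B) + `|c|) => x.
have [dh h_le h'_le] := hC x.
rewrite hornerMXaddC; split.
- rewrite (_ : (fun y => _) = (fun y => p.[phi y]) * phi + cst c); last first.
    by apply/funext => y; rewrite hornerMXaddC.
  rewrite -[X in is_derive _ _ _ X]addr0; apply: is_deriveD.
  exact: is_deriveM.
- apply: le_trans (ler_normD _ _) _; rewrite lerD2r normrM mulr_natl mulr2n.
  by apply: le_trans (ler_pM _ _ h_le (phiB x)) _ => //; rewrite lerDl mulr_ge0.
- apply: le_trans (ler_normD _ _) _; rewrite !normrM mulr_natl mulr2n.
  apply: ler_wpDr => //; apply: lerD; first by rewrite ler_pM.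
  by rewrite mulrC ler_pM.
Qed.

Lemma derive_gt0_increasing (R : realType) (g g' : R -> R) :
  (forall x : R, is_derive x 1 g (g' x)) -> (forall x, 0 < g' x) ->
  {homo g : x y / x < y}.
Proof.
move=> dg g'_gt0 x y xy.
have cg : {within `[x, y], continuous g}.
  by apply: derivable_within_continuous => z _; apply: ex_derive.
have [c _ g_xy] := MVT xy (fun z _ => dg z) cg.
by rewrite -subr_gt0 g_xy mulr_gt0 // subr_gt0.
Qed.

(** The value [v] lies between [g (v - d)] and [g (v + d)], so the intermediate value theorem
    applies. *)
Lemma near_id_surjective (R : realType) (g : R -> R) (d : R) :
  continuous g -> (forall x, `|g x - x| <= d) -> forall v, exists x, g x = v.
Proof.
move=> cg g_id v.
have d_ge0 : 0 <= d by apply: le_trans (g_id 0).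
have le_vd : v - d <= v + d by lra.
have gl : g (v - d) <= v by have := g_id (v - d); rewrite ler_norml; lra.
have gr : v <= g (v + d) by have := g_id (v + d); rewrite ler_norml; lra.
have [||x _ gx] := @IVT R g _ _ v le_vd; last by exists x.
  exact: continuous_subspaceT.
by rewrite ge_min le_max gl gr orbT.
Qed.

Lemma inj_surj_bijective (T S : choiceType) (g : T -> S) :
  injective g -> (forall v, exists x, g x = v) -> bijective g.
Proof.
move=> g_inj /choice[g1 g1K].
by exists g1 => // x; apply: g_inj; rewrite g1K.
Qed.

Lemma perturb_id_bijection (R : realType) (h h' : R -> R) (C t : R) :
  (forall x : R, is_derive x 1 h (h' x)) ->
  (forall x, `|h x| <= C) -> (forall x, `|h' x| <= C) ->
  0 < t -> t * C < 1 ->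
  [/\ bijective (fun x => x + t * h x),
      continuous (fun x => x + t * h x),
      forall x : R, derivable (fun x => x + t * h x) x 1
    & {homo (fun x => x + t * h x) : x y / x < y}].
Proof.
move=> dh hC h'C t_gt0 tC; set g := fun x => _.
have dg (x : R) : is_derive x 1 g (1 + t * h' x).
  have dth : is_derive x 1 (t *: h) (t * h' x) by exact: is_deriveZ.
  exact: (is_deriveD (is_derive_id x 1) dth).
have dg1 (x : R) : derivable g x 1 by apply: ex_derive.
have cg : continuous g.
  by move=> x; apply/differentiable_continuous/derivable1_diffP.
have g_incr : {homo g : x y / x < y}.
  apply: derive_gt0_increasing dg _ => x.
  (* This makes the derivative [1 + t * h' x] positive. *)
  have : `|t * h' x| < 1.
    by rewrite normrM gtr0_norm // (le_lt_trans _ tC) // ler_pM2l.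
  by rewrite ltr_norml; lra.
split=> //; apply: inj_surj_bijective; first exact: inc_inj (le_mono g_incr).
apply: (@near_id_surjective _ _ (t * C)) cg _ => x.
by rewrite /g addrC addKr normrM gtr0_norm // ler_pM2l.
Qed.

Lemma atan_interpolation (R : realType) (f : R -> R) (s : seq R) :
  exists (h h' : R -> R) (C : R),
    (forall x, x \in s -> h x = f x) /\
    forall x : R, [/\ is_derive x 1 h (h' x), `|h x| <= C & `|h' x| <= C].
Proof.
have atan_inj : injective (@atan R) by apply: can_inj (@atanK R).
have [p p_s] := poly_interpolation f s atan_inj.
(* The constant [pi / 2 + 1] bounds both [atan], by [pi / 2], and its derivative [(1 + x ^+ 2)^-1],
   by [1]. *)
have := @poly_comp_bounded_derive R atan _ (pi / 2 + 1) p (@is_derive1_atan R).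
case=> [x|x|h' [C hC]]; last by exists (fun x => p.[atan x]), h', C.
- by rewrite ler_norml; have := atan_gtNpi2 x; have := atan_ltpi2 x; lra.
- have sqx : 0 < 1 + x ^+ 2 by rewrite ltr_pwDl // sqr_ge0.
  rewrite ger0_norm ?invr_ge0 ?(ltW sqx) //.
  have : (1 + x ^+ 2)^-1 <= 1 by rewrite invf_le1 // lerDl sqr_ge0.
  by have := pi_ge0 R; lra.
Qed.

Theorem theorem3 (R : realType) (M N : nat) (A : 'M[R]_(M, N)) (K : nat)
    (K_gt0 : (0 < K)%N)
    (rank_f : exists f : R -> R, (K <= \rank (map_mx f A))%N) :
  exists g : R -> R,
    [/\ bijective g,
        continuous g,
        piecewise_differentiable g,
        {homo g : x y / x < y}
      & (K <= \rank (map_mx g A))%N].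
Proof.
have [f /rank_ge_mulmx1[U [V UfV]]] := rank_f.
have [h [h' [C [h_f hC]]]] :=
  atan_interpolation f [seq A ij.1 ij.2 | ij : 'I_M * 'I_N].
have C_ge0 : 0 <= C by have [_ + _] := hC 0; apply: le_trans.
(* Substituting [- 'X] turns the excluded values [- t] into roots [t], so that a small positive
   non-root can be picked. *)
have q_neq0 : char_poly (U *m A *m V) \Po (- 'X) != 0.
  rewrite -size_poly_eq0 size_comp_poly2 ?size_polyN ?size_polyX //.
  by rewrite size_poly_eq0 monic_neq0 // char_poly_monic.
(* [C] may be zero, hence [C + 1]; [t < (C + 1)^-1] still gives [t * C < 1]. *)
have e_gt0 : 0 < (C + 1)^-1 by rewrite invr_gt0 ltr_wpDl.
have [t /andP[t_gt0 t_lt] tNroot] := poly_nonroot_small q_neq0 e_gt0.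
have tC : t * C < 1.
  by move: t_lt; rewrite -[_^-1]mul1r ltr_pdivlMr ?ltr_wpDl //; lra.
have [g_bij g_cont g_der g_incr] := @perturb_id_bijection R h h' C t
  (fun x => let: And3 d _ _ := hC x in d)
  (fun x => let: And3 _ b _ := hC x in b)
  (fun x => let: And3 _ _ b := hC x in b) t_gt0 tC.
(* [g] is differentiable everywhere, so the list of breakpoints is empty. *)
exists (fun x => x + t * h x); split=> //; first by exists [::].
rewrite (_ : map_mx _ A = A + t *: map_mx f A); last first.
  apply/matrixP => i j; rewrite !mxE h_f //.
  by apply/fintype.imageP; exists (i, j).
apply: rank_addZ_ge UfV _.
by move: tNroot; rewrite /root horner_comp !hornerE.
Qed.
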